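(* $\operatorname{ex}_T(\alpha)<1$ for all $\alpha \in (0, \tfrac12)$.
   Context: Let $\mathbb{T}=\mathbb{R}/\mathbb{Z}$ and $\mu$ the Lebesgue (Haar) measure on $\mathbb{T}^k$ for each $k$. For an integer $n>1$, let $\pi_1:\mathbb{T}^n\to\mathbb{T}^{n-1}$ be the projection forgetting the first coordinate and $\pi_n:\mathbb{T}^n\to\mathbb{T}^{n-1}$ the projection forgetting the last coordinate. Define $\operatorname{ex}_T(n,\alpha)=\inf\{\mu(\pi_1(B)+\pi_n(B)) : B\subseteq\mathbb{T}^n \text{ open},\ \mu(B)>\alpha\}$ and $\operatorname{ex}_T(\alpha)=\lim_{n\to\infty}\operatorname{ex}_T(n,\alpha)$ (this limit exists since $\operatorname{ex}_T(n,\alpha)$ is non-increasing in $n$). *)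

(* Defs.v *)
From HB Require Import structures.
From mathcomp Require Import all_boot all_order all_algebra.
From mathcomp Require Import all_classical all_reals all_analysis.
From mathcomp Require Import measurable_realfun.

Set Implicit Arguments.
Unset Strict Implicit.
Unset Printing Implicit Defensive.

Import Order.TTheory GRing.Theory Num.Theory.
Import numFieldNormedType.Exports.

Local Open Scope classical_set_scope.
Local Open Scope ring_scope.

Section circle.
Variable R : realType.

Definition int_subgroup : zmodClosed R :=
  GRing.ZmodClosed.clone R (@Num.int_num_subdef R) _.

Definition circle := quotient_topology (Quotient.quot int_subgroup).

HB.instance Definition _ := Topological.on circle.
HB.instance Definition _ := PointedTopological.on circle.
HB.instance Definition _ := Quotient.on circle.
HB.instance Definition _ := GRing.isZmodule.Build circle
  (@Quotient.addqA R int_subgroup) (@Quotient.addqC R int_subgroup)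
  (@Quotient.add0q R int_subgroup) (@Quotient.addNq R int_subgroup).

HB.instance Definition _ :=
  Measurable.copy circle (g_sigma_algebraType (@open circle)).

Definition circle_pi : R -> circle := \pi_circle%qT.

Lemma circle_piP (x y : R) :
  circle_pi x = circle_pi y <-> x - y \is a Num.int.
Proof.
have E := Quotient.idealrBE int_subgroup x y.
split=> [xy|xyZ]; last first.
  have : x - y \in int_subgroup by [].
  by rewrite E => /eqP; exact.
suff : x - y \in int_subgroup by [].
by rewrite E; apply/eqP; exact: xy.
Qed.

Lemma open_circle_pi (U : set R) : open U -> open (circle_pi @` U).
Proof.
move=> oU.
have -> : open (circle_pi @` U) = open (circle_pi @^-1` (circle_pi @` U)) by [].
have -> : circle_pi @^-1` (circle_pi @` U) =
    \bigcup_(k in [set: int]) ((fun x => x + k%:~R) @^-1` U).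
  apply/seteqP; split => [x [y Uy /circle_piP/intrP[k yxk]]|x [k _ /= Uxk]].
    by exists k => //=; rewrite -yxk addrC subrK.
  exists (x + k%:~R) => //; apply/circle_piP.
  by rewrite addrAC subrr add0r; exact: intr_int.
apply: bigcup_open => k _; apply: open_comp oU => x _.
by apply: continuousD; [exact: cvg_id|exact: cst_continuous].
Qed.

Lemma measurable_circle_pi : measurable_fun [set: R] circle_pi.
Proof.
apply: (@measurability _ _ _ _ _ _ (@open circle)) => // _ [U oU <-].
rewrite setTI; apply: open_measurable; exact: oU.
Qed.

(* The fundamental domain [0, 1[ identifies Lebesgue measure on R/Z with the
   restriction of Lebesgue measure on R. *)
Definition circle_measure : set circle -> \bar R :=
  pushforward (mrestr lebesgue_measure (measurable_itv `[(0:R), 1[)) circle_pi.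

Let circle_measure0 : circle_measure set0 = 0%E.
Proof. by rewrite /circle_measure /pushforward preimage_set0 measure0. Qed.

Let circle_measure_ge0 A : (0 <= circle_measure A)%E.
Proof. by rewrite /circle_measure /pushforward; exact: measure_ge0. Qed.

Let circle_measure_sigma_additive : semi_sigma_additive circle_measure.
Proof.
have mpi A : measurable A -> measurable (circle_pi @^-1` A).
  by move=> mA; rewrite -[X in measurable X]setTI; exact: measurable_circle_pi.
move=> F mF tF mUF; rewrite /circle_measure /pushforward preimage_bigcup.
apply: measure_semi_sigma_additive => [n||]; first exact: mpi.
- apply/trivIsetP => /= i j _ _ ij; rewrite -preimage_setI.
  by move/trivIsetP : tF => /(_ _ _ _ _ ij) ->//; rewrite preimage_set0.
- by rewrite -preimage_bigcup; exact: mpi.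
Qed.

HB.instance Definition _ := isMeasure.Build _ _ _ circle_measure
  circle_measure0 circle_measure_ge0 circle_measure_sigma_additive.

Let circle_measureT : circle_measure setT = 1%E.
Proof.
rewrite /circle_measure /pushforward preimage_setT /mrestr setTI.
by rewrite lebesgue_measure_itv/= lte_fin ltr01 sube0.
Qed.

HB.instance Definition _ := Measure_isProbability.Build _ _ R circle_measure
  circle_measureT.

End circle.

Section torus.
Variable R : realType.
Local Notation T n := 'rV[circle R]_n.

(* T^n carries the product sigma-algebra; as T is second countable, it contains
   the open sets (torus_open_measurable below). *)
Section sigma_algebra.
Variable n : nat.

Let coor (i : 'I_n) (v : T n) : circle R := v ord0 i.

Let torus_set0 : g_sigma_preimage coor set0.
Proof. exact: sigma_algebra0. Qed.

Let torus_setC A : g_sigma_preimage coor A -> g_sigma_preimage coor (~` A).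
Proof. exact: sigma_algebraC. Qed.

Let torus_bigcup (F : (set (T n))^nat) :
  (forall i, g_sigma_preimage coor (F i)) ->
  g_sigma_preimage coor (\bigcup_i F i).
Proof. exact: sigma_algebra_bigcup. Qed.

HB.instance Definition _ := @isMeasurable.Build default_measure_display
  (T n) (g_sigma_preimage coor) torus_set0 torus_setC torus_bigcup.

Lemma measurable_coor (i : 'I_n) :
  measurable_fun [set: T n] (fun v : T n => v ord0 i).
Proof.
move=> _ Y mY; rewrite setTI; apply: sub_sigma_algebra => /=.
rewrite -bigcup_seq/=; exists i => /=; first by rewrite mem_index_enum.
by exists Y => //; rewrite setTI.
Qed.

Lemma measurable_torusP d (S : measurableType d) (f : S -> T n) :
  (forall i, measurable_fun [set: S] (fun x => f x ord0 i)) ->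
  measurable_fun [set: S] f.
Proof.
move=> mf; apply: (@measurability _ _ _ _ _ _
  (\big[setU/set0]_(i < n) preimage_set_system setT (coor i) measurable)) => //.
move=> _ [B + <-]; rewrite -bigcup_seq => -[i _ [C mC <-]].
rewrite !setTI; move: (mf i measurableT C mC); by rewrite setTI.
Qed.

End sigma_algebra.

Definition torus_cons n (p : circle R * T n) : T n.+1 :=
  row_mx (const_mx p.1 : 'rV_1) p.2.

Lemma torus_consE0 n (p : circle R * T n) : torus_cons p ord0 ord0 = p.1.
Proof.
have <- : (const_mx p.1 : 'rV_1) ord0 ord0 = p.1 by rewrite mxE.
rewrite -[RHS](row_mxEl _ p.2); congr (row_mx _ _ _ _); exact: val_inj.
Qed.

Lemma torus_consES n (p : circle R * T n) i :
  torus_cons p ord0 (lift ord0 i) = p.2 ord0 i.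
Proof.
rewrite -[RHS](row_mxEr (const_mx p.1 : 'rV_1)).
by congr (row_mx _ _ _ _); exact: val_inj.
Qed.

Lemma measurable_torus_cons n : measurable_fun setT (@torus_cons n).
Proof.
apply: measurable_torusP => i; case: (unliftP ord0 i) => [j|] ->.
  under eq_fun do rewrite torus_consES.
  exact: (measurableT_comp (measurable_coor j) measurable_snd).
under eq_fun do rewrite torus_consE0.
exact: measurable_fst.
Qed.

HB.instance Definition _ n :=
  isMeasurableFun.Build _ _ _ _ (@torus_cons n) (@measurable_torus_cons n).

(* The n-fold product of circle_measure, transported along T * T^m ~ T^(m+1). *)
Fixpoint torus_measure n : probability (T n) R :=
  match n with
  | 0 => \d_(0 : T 0)
  | m.+1 => distribution (@circle_measure R \x torus_measure m)%E (@torus_cons m)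
  end.

Definition drop_first {n} (v : T n.+1) : T n := col' ord0 v.

Definition drop_last {n} (v : T n.+1) : T n := col' ord_max v.

Definition sumset n (A B : set (T n)) : set (T n) :=
  [set x + y | x in A & y in B].

(* Shifted index: exTS n alpha is ex_T(n + 1, alpha), where B ranges over the
   open subsets of T^(n + 1). *)
Definition exTS n (alpha : R) : \bar R :=
  ereal_inf [set torus_measure n (sumset (drop_first @` B) (drop_last @` B)) |
             B in [set B : set (T n.+1) |
                   open B /\ (alpha%:E < torus_measure n.+1 B)%E]].

(* The limit exists by is_cvg_exTS below. *)
Definition exT (alpha : R) : \bar R := limn (fun n => exTS n alpha).

Lemma torus_open_measurable n (A : set (T n)) : open A -> measurable A.
Proof.
move=> oA.
pose box (q : {ffun 'I_n -> rat * rat}) : set (T n) := [set v |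
  forall i, (@circle_pi R @` `](ratr (q i).1), (ratr (q i).2)[) (v ord0 i)].
have -> : A = \bigcup_q (if `[< box q `<=` A >] then box q else set0).
  apply/seteqP; split => [v Av|v [q _]]; last by case: ifPn => // /asboolP; apply.
  have [P Pv PA] : nbhs v A by apply: open_nbhs_nbhs.
  have ex i : exists q : rat * rat,
    (@circle_pi R @` `](ratr q.1), (ratr q.2)[) (v ord0 i) /\
    @circle_pi R @` `](ratr q.1), (ratr q.2)[ `<=` P ord0 i.
    have := Pv ord0 i.
    rewrite nbhsE => -[U [oU Uv] UP].
    have : nbhs (repr (v ord0 i) : R) (@circle_pi R @^-1` U).
      by apply: open_nbhs_nbhs; split; [exact: oU|rewrite /= /circle_pi reprK].
    move=> /nbhs_ballP[e /= e0 eU].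
    set x : R := repr (v ord0 i) in eU *.
    have /rat_in_itvoo[a ax] : x - e < x by rewrite ltrBlDr ltrDl.
    have /rat_in_itvoo[b bx] : x < x + e by rewrite ltrDl.
    exists (a, b); split => /=.
      exists x; last by rewrite /x /circle_pi reprK.
      by rewrite /= in_itv /= (itvP ax) (itvP bx).
    move=> _ [y /= yab <-]; apply: UP; apply: eU.
    rewrite /ball /= ltr_distlC; move: yab; rewrite in_itv /= => /andP[ay yb].
    by rewrite (lt_trans _ ay) ?(itvP ax)//= (lt_trans yb)// (itvP bx).
  pose q := [ffun i => xget (0, 0) [set q : rat * rat |
    (@circle_pi R @` `](ratr q.1), (ratr q.2)[) (v ord0 i) /\
    @circle_pi R @` `](ratr q.1), (ratr q.2)[ `<=` P ord0 i]].
  have qP i : (@circle_pi R @` `](ratr (q i).1), (ratr (q i).2)[) (v ord0 i) /\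
    @circle_pi R @` `](ratr (q i).1), (ratr (q i).2)[ `<=` P ord0 i.
    rewrite ffunE; have [q' q'P] := ex i; exact: (xgetPex (0, 0) (ex i)).
  exists q => //; case: ifPn => [_ i|/asboolP]; first by have [] := qP i.
  case => w boxw; apply: PA => i j; rewrite (ord1 i).
  by have [_] := qP j; apply; exact: boxw.
apply: countable_bigcupT_measurable => [|q]; first exact: countableP.
case: ifPn => // _.
have -> : box q = \bigcap_(i in [set: 'I_n]) ((fun v : T n => v ord0 i) @^-1`
    (@circle_pi R @` `](ratr (q i).1), (ratr (q i).2)[)).
  by apply/seteqP; split => v vq i; [move=> _|]; exact: vq.
apply: fin_bigcap_measurable => // i _.
rewrite -[X in measurable X]setTI; apply: measurable_coor => //.
apply: sub_sigma_algebra; apply: open_circle_pi; exact: interval_open.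
Qed.

Lemma torus_consK n (p : circle R * T n) : drop_first (torus_cons p) = p.2.
Proof.
by apply/matrixP => i j; rewrite (ord1 i) /drop_first mxE torus_consES.
Qed.

Lemma drop_first_last n (v : T n.+2) :
  drop_first (drop_last v) = drop_last (drop_first v).
Proof.
apply/matrixP => i j; rewrite /drop_first /drop_last !mxE; congr (v i _).
by apply/val_inj; rewrite /= /bump /= !add1n ltnS addnS.
Qed.

Lemma drop_firstB n (v w : T n.+1) :
  drop_first (v - w) = drop_first v - drop_first w.
Proof. by apply/matrixP => i j; rewrite !mxE. Qed.

Lemma drop_firstD n (v w : T n.+1) :
  drop_first (v + w) = drop_first v + drop_first w.
Proof. by apply/matrixP => i j; rewrite !mxE. Qed.

Lemma open_drop_first n (B : set (T n)) :
  open B -> open (drop_first @^-1` B).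
Proof.
rewrite !openE => oB v /oB [P Pv PB].
exists (fun i j => if unlift ord0 j is Some k then P i k else setT).
  move=> i j; case: unliftP => [k ->|_]; last exact: filterT.
  by have := Pv i k; rewrite mxE.
move=> w Pw; apply: PB => i j; have := Pw i (lift ord0 j).
by rewrite liftK mxE.
Qed.

Lemma torus_measure_drop_first n (B : set (T n)) :
  torus_measure n.+1 (drop_first @^-1` B) = torus_measure n B.
Proof.
rewrite /= /distribution /pushforward.
have -> : @torus_cons n @^-1` (drop_first @^-1` B) = setT `*` B.
  by apply/seteqP; split => p; rewrite /= torus_consK => // -[].
rewrite /product_measure1.
under eq_integral do rewrite /= in_xsectionX ?in_setT//.
by rewrite integral_cst//= probability_setT mule1.
Qed.

Lemma nonincreasing_exTS alpha : nonincreasing_seq (exTS ^~ alpha).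
Proof.
apply/nonincreasing_seqP => n; apply: le_ereal_inf_tmp => _ [B [oB aB] <-].
apply: ereal_inf_lbound; exists (drop_first @^-1` B).
  by split; [exact: open_drop_first|rewrite torus_measure_drop_first].
rewrite -[RHS]torus_measure_drop_first; congr (torus_measure _ _).
apply/seteqP; split => [_ [_ [u Bu <-] [_ [w Bw <-] <-]]|x].
  rewrite /= drop_firstD drop_first_last; exists (drop_first (drop_first u)).
    by exists (drop_first u).
  by exists (drop_last (drop_first w)) => //; exists (drop_first w).
move=> [_ [u Bu <-] [_ [w Bw <-] xuw]].
exists u; first by exists (torus_cons (0, u)); rewrite /= torus_consK.
exists (x - u); last by rewrite addrC subrK.
exists (torus_cons ((x - u) ord0 ord0, w)); first by rewrite /= torus_consK.
set y := torus_cons _.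
have yE : drop_first (drop_last y) = drop_first (x - u).
  by rewrite drop_first_last torus_consK drop_firstB -xuw addrAC subrr add0r.
apply/matrixP => i j; rewrite (ord1 i); case: (unliftP ord0 j) => [k|] ->.
  by have /matrixP/(_ ord0 k) := yE; rewrite [LHS]mxE [RHS]mxE.
rewrite [LHS]mxE (_ : lift _ _ = ord0) ?torus_consE0//.
by apply/val_inj; rewrite /= /bump.
Qed.

Lemma is_cvg_exTS alpha : cvgn (exTS ^~ alpha).
Proof. exact/ereal_nonincreasing_is_cvgn/nonincreasing_exTS. Qed.

End torus.

(* Main.v *)
(* Take disjoint arcs U = ]0, d[ and V = ]d + e, 1 - e[ of the circle, and let B
   consist of the points whose first coordinate lying in U has odd (0-based)
   index, all earlier coordinates being in V.  If u is in U and v is in V then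
   u + v avoids the arc W = ]d - e, d + e[.  Hence if x, y are in B and all
   x_(i+1) + y_i are in W, then x_(i+1) is in U (V) forces y_i out of V (U), so
   the first hits of x and y differ by exactly one, against parity: the sumset
   misses the cube over W, which has positive measure.  This is a robust
   version of Rokhlin's lemma for the shift: with p = |U|, q = |V|, the measure
   of B is p (q + q^3 + ...), close to p q / (1 - q^2), which tends to 1/2 when
   d -> 0 and e << d. *)
Require Import Defs.
From mathcomp Require Import all_boot all_order all_algebra.
From mathcomp Require Import all_classical all_reals all_analysis.
From mathcomp Require Import lra ring.
Import Order.TTheory GRing.Theory Num.Theory.
Import numFieldNormedType.Exports.

Set Implicit Arguments.
Unset Strict Implicit.
Unset Printing Implicit Defensive.

Local Open Scope classical_set_scope.
Local Open Scope ring_scope.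

(** * Open arcs of the circle *)

Definition arc (R : realType) (a b : R) : set (circle R) :=
  @circle_pi R @` `]a, b[.

(** Reduces questions about arcs to linear arithmetic: congruent representatives less than 1 apart
    coincide. *)
Lemma int_norm_lt1 (R : realType) (x : R) :
  x \is a Num.int -> -1 < x -> x < 1 -> x = 0.
Proof.
move=> /intrP[k ->]; rewrite -(mulrN1z 1) ltr_int => k_gtN1.
by rewrite -[X in _ < X](mulr1z 1) ltr_int; case: k k_gtN1 => [[|k]|[|k]].
Qed.

Lemma open_arc (R : realType) (a b : R) : open (arc a b).
Proof. by apply: open_circle_pi; exact: interval_open. Qed.

Lemma circle_measurable (R : realType) (A : set (circle R)) :
  open A -> measurable A.
Proof. exact: sub_sigma_algebra. Qed.

Lemma circle_measure_arc (R : realType) (a b : R) :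
  0 <= a -> a <= b -> b <= 1 -> @circle_measure R (arc a b) = (b - a)%:E.
Proof.
move=> a0 ab b1; rewrite /circle_measure /pushforward /mrestr.
rewrite (_ : _ `&` _ = `]a, b[%classic); last first.
  apply/seteqP; split => [x [[y yab /circle_piP yx] x01]|x xab]; last first.
    split; first by exists x.
    by move: xab; rewrite /= !in_itv/= => /andP[? ?]; apply/andP; split; lra.
  suff -> : x = y by [].
  move: yab x01; rewrite /= !in_itv/= => /andP[? ?] /andP[? ?].
  by have := int_norm_lt1 yx; lra.
rewrite lebesgue_measure_itv/= lte_fin; case: ltP => [//|ba].
have -> : b = a by apply/eqP; rewrite eq_le ab ba.
by rewrite subrr.
Qed.

Lemma circle_piD (R : realType) (x y : R) :
  @circle_pi R x + @circle_pi R y = @circle_pi R (x + y).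
Proof. exact/esym/(Quotient.pi_add (@int_subgroup R)). Qed.

Lemma circle_piB (R : realType) (x y : R) :
  @circle_pi R x - @circle_pi R y = @circle_pi R (x - y).
Proof. by apply/eqP; rewrite subr_eq circle_piD subrK. Qed.

(** Lifts of [x + y] lie in ]a + c, b + d[, which the hypotheses place between ]e, f[ and its
    translate by 1. *)
Lemma arc_add_disjoint (R : realType) (a b c d e f : R) :
  f <= a + c -> b + d <= 1 + e ->
  forall x y, arc a b x -> arc c d y -> arc e f (x + y) -> False.
Proof.
move=> fac bde _ _ [x xab <-] [y ycd <-]; rewrite circle_piD.
move=> [z + /circle_piP zxy].
move: xab ycd; rewrite /= !in_itv/= => /andP[? ?] /andP[? ?] /andP[? ?].
by have := int_norm_lt1 zxy; lra.
Qed.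

Lemma arc_disjoint (R : realType) (a b c d : R) :
  0 <= a -> b <= c -> d <= 1 -> arc a b `&` arc c d = set0.
Proof.
move=> a0 bc d1; apply/seteqP; split => // _ [[x xab <-] [y ycd /circle_piP yx]].
move: xab ycd; rewrite /= !in_itv/= => /andP[? ?] /andP[? ?].
by have := int_norm_lt1 yx; lra.
Qed.

(** * Cylinders and openness in the torus *)

Section cylinder.
Variable R : realType.
Local Notation T n := 'rV[circle R]_n.

Definition cylinder n (A : set (circle R)) (B : set (T n)) : set (T n.+1) :=
  [set v : T n.+1 | A (v ord0 ord0) /\ B (drop_first v)].

Lemma open_cylinder n A (B : set (T n)) :
  open A -> open B -> open (cylinder A B).
Proof.
move=> oA oB; apply: openI; last exact: open_drop_first.
move: oA; rewrite !openE => oA v Av.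
exists (fun i j => if j == ord0 then A else setT) => /=.
  move=> i j; case: eqP => [->|_]; last exact: filterT.
  by rewrite (ord1 i); apply: oA.
by move=> w /(_ ord0 ord0); rewrite eqxx.
Qed.

Lemma torus_measure_cylinder n A (B : set (T n)) : open A -> open B ->
  torus_measure R n.+1 (cylinder A B) =
  (@circle_measure R A * torus_measure R n B)%E.
Proof.
move=> oA oB; rewrite /= /distribution /pushforward.
have -> : @torus_cons R n @^-1` (cylinder A B) = A `*` B.
  by apply/seteqP; split => p; rewrite /cylinder/= torus_consK torus_consE0.
by rewrite product_measure1E//; [exact: circle_measurable|
  exact: torus_open_measurable].
Qed.

Lemma nbhs_circleB (x c : circle R) (A : set (circle R)) :
  nbhs (x - c) A -> nbhs x [set y | A (y - c)].
Proof.
rewrite nbhsE => -[U [oU Ux] UA]; rewrite nbhsE.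
exists [set y | U (y - c)]; last by move=> y; exact: UA.
split=> //; have [r ->] : exists r, c = @circle_pi R r.
  by exists (repr c); rewrite /circle_pi reprK.
(* In the quotient topology, a set is open by definition when its lift to [R] is. *)
have -> : open [set y : circle R | U (y - @circle_pi R r)] =
  open ((@circle_pi R) @^-1` [set y | U (y - @circle_pi R r)]) by [].
rewrite (_ : _ @^-1` _ = (fun s => s - r) @^-1` (@circle_pi R @^-1` U)).
  have oD (D : set R) : open D -> open ((fun s : R => s - r) @^-1` D).
    by apply: open_comp => s _; apply: cvgB; [exact: cvg_id|exact: cvg_cst].
  by apply: oD; exact: oU.
by apply/funext => s; rewrite /= circle_piB.
Qed.

(** A sumset is a union of translates of [A]. With the next lemma, this will make the sumset in
    question measurable. *)
Lemma open_sumset n (A B : set (T n)) : open A -> open (sumset A B).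
Proof.
rewrite !openE => oA _ [a /oA[P Pa PA] [b Bb <-]].
exists (fun i j => [set y | P i j (y - b i j)]) => [i j|w Pw].
  by apply: nbhs_circleB; rewrite mxE addrK.
exists (w - b); last by exists b => //; rewrite subrK.
by apply: PA => i j; have := Pw i j; rewrite /= !mxE.
Qed.

Lemma open_drop_first_image n (B : set (T n.+1)) :
  open B -> open (@drop_first R n @` B).
Proof.
rewrite !openE => oB _ [v /oB[P Pv PB] <-].
exists (fun i j => P i (lift ord0 j)) => [i j|w Pw].
  by have := Pv i (lift ord0 j); rewrite mxE.
(* Keeping the first coordinate of [v] stays inside the box [P]. *)
exists (torus_cons (v ord0 ord0, w)); last by rewrite torus_consK.
apply: PB => i j; rewrite (ord1 i); case: (unliftP ord0 j) => [k|] ->.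
  by rewrite torus_consES; exact: Pw.
by rewrite torus_consE0; exact: nbhs_singleton (Pv _ _).
Qed.

(* Some coordinate is in U, its index has parity b (true for odd), and all the
   coordinates before it are in V. *)
Fixpoint first_hit (U V : set (circle R)) (b : bool) (n : nat) : set (T n) :=
  match n with
  | 0 => set0
  | m.+1 => (if b then set0 else cylinder U setT) `|`
            cylinder V (@first_hit U V (~~ b) m)
  end.

Fixpoint cube (W : set (circle R)) (n : nat) : set (T n) :=
  match n with
  | 0 => setT
  | m.+1 => cylinder W (@cube W m)
  end.

Arguments first_hit U V b n : clear implicits.
Arguments cube W n : clear implicits.

(** * Measures and sums of first-hit sets *)

Lemma open_first_hit U V b n : open U -> open V -> open (first_hit U V b n).
Proof.
move=> oU oV; elim: n b => [|n IHn] b /=; first exact: open0.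
apply: openU; last exact: open_cylinder.
by case: b; [exact: open0|apply: open_cylinder => //; exact: openT].
Qed.

Lemma open_cube W n : open W -> open (cube W n).
Proof.
move=> oW; elim: n => [|n IHn] /=; first exact: openT.
exact: open_cylinder.
Qed.

Lemma torus_measure_cube W n (w : R) : open W ->
  @circle_measure R W = w%:E -> torus_measure R n (cube W n) = (w ^+ n)%:E.
Proof.
move=> oW mW; elim: n => [|n IHn]; first by rewrite probability_setT.
rewrite torus_measure_cylinder//; last exact: open_cube.
by rewrite IHn mW -EFinM exprS.
Qed.

(** Hits of opposite parity have different indices. At the earlier one, a point is in [U] and the
    other in [V], so their sum misses [W]. That index is below [n], as [x] has only [n] coordinates,
    so [drop_last] does not lose it. *)
Lemma first_hit_shift U V W b n (x : T n) (y : T n.+1) :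
  (forall u v, U u -> V v -> W (u + v) -> False) ->
  first_hit U V (~~ b) n x -> first_hit U V b n.+1 y ->
  cube W n (x + drop_last y) -> False.
Proof.
move=> UVW; elim: n b x y => [//|n IHn] b x y hx hy [Wxy].
rewrite drop_firstD drop_first_last => cxy.
have {}Wxy : W (x ord0 ord0 + y ord0 ord0).
  move: Wxy; rewrite !mxE (_ : lift _ _ = ord0 :> 'I_n.+2)//.
  exact: val_inj.
case: hx => [hx|[Vx hx]].
  case: b hx hy => //= -[Ux _] [//|[Vy _]]; exact: UVW Ux Vy Wxy.
case: hy => [hy|[Vy hy]].
  case: b hx hy => //= _ [Uy _]; apply: UVW Uy Vx _; by rewrite addrC.
by apply: (IHn (~~ b)) hx hy cxy.
Qed.

Lemma torus_measure_first_hit U V b n (p q : R) : open U -> open V ->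
  U `&` V = set0 ->
  @circle_measure R U = p%:E -> @circle_measure R V = q%:E ->
  torus_measure R n.+1 (first_hit U V b n.+1) =
  ((if b then 0 else p)%:E + q%:E * torus_measure R n (first_hit U V (~~ b) n))%E.
Proof.
move=> oU oV UV mU mV.
have oh b' m := @open_first_hit U V b' m oU oV.
have oVh := open_cylinder oV (oh (~~ b) n).
have -> : torus_measure R n.+1 (first_hit U V b n.+1) =
   (torus_measure R n.+1 (if b then set0 else cylinder U setT) +
    torus_measure R n.+1 (cylinder V (first_hit U V (~~ b) n)))%E.
  apply: measureU; [|exact: torus_open_measurable|].
    case: b {oVh} => //; apply: torus_open_measurable.
    by apply: open_cylinder => //; exact: openT.
  case: b {oVh} => /=; first by rewrite set0I.
  apply/seteqP; split => // v [[Uv _] [Vv _]].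
  by have : (U `&` V) (v ord0 ord0) by []; rewrite UV.
rewrite (torus_measure_cylinder oV)// mV; congr (_ + _)%E.
case: b {oVh}; first by rewrite measure0.
rewrite torus_measure_cylinder//; last exact: openT.
by rewrite probability_setT mule1.
Qed.

(** Two steps of the recurrence give the map t |-> q (p + q t), whose iterates from 0 are these
    geometric sums. *)
Lemma torus_measure_odd_first_hit U V m (p q : R) : open U -> open V ->
  U `&` V = set0 -> 1 - q ^+ 2 != 0 ->
  @circle_measure R U = p%:E -> @circle_measure R V = q%:E ->
  torus_measure R m.*2 (first_hit U V true m.*2) =
  (p * q / (1 - q ^+ 2) * (1 - q ^+ m.*2))%:E.
Proof.
move=> oU oV UV q1 mU mV; elim: m => [|m IHm].
  by rewrite measure0 expr0 subrr mulr0.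
rewrite doubleS 2!(torus_measure_first_hit _ _ oU oV UV mU mV)/= IHm.
rewrite -!(EFinM, EFinD); congr EFin; rewrite !exprS expr0.
by field.
Qed.

End cylinder.

Arguments first_hit {R} U V b n.
Arguments cube {R} W n.

(** * Strict bound on the sumset and choice of the parameters *)

Lemma geometric_gt (R : realType) (q a L : R) :
  `|q| < 1 -> a < L -> exists m, a < L * (1 - q ^+ m.*2).
Proof.
move=> q1 aL.
have cL : (fun n => L * (1 - q ^+ n)) @ \oo --> L.
  rewrite -[X in _ --> X]mulr1 -[X in _ --> L * X](subr0 1).
  apply: cvgM; first exact: cvg_cst.
  by apply: cvgB; [exact: cvg_cst|exact: cvg_expr].
have [N _ hN] := cvgr_gt _ cL _ aL.
by exists N; apply: hN; rewrite /= -addnn leq_addl.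
Qed.

Lemma measure_sumset_lt1 (R : realType) n (U V W : set (circle R)) (w : R) :
  open U -> open V -> open W ->
  (forall u v, U u -> V v -> W (u + v) -> False) ->
  @circle_measure R W = w%:E -> 0 < w ->
  (torus_measure R n.+1 (sumset (@drop_first R n.+1 @` first_hit U V true n.+2)
     (@drop_last R n.+1 @` first_hit U V true n.+2)) < 1)%E.
Proof.
move=> oU oV oW UVW mW w0; set S := sumset _ _.
have oC : open (cube W n.+1) by exact: open_cube.
have oS : open S.
  by apply/open_sumset/open_drop_first_image/open_first_hit.
have SC : S `<=` ~` cube W n.+1.
  move=> _ [_ [x hx <-] [_ [y hy <-] <-]].
  (* An odd hit is not at index 0, so dropping the first coordinate of [x] leaves an even hit. *)
  case: hx => // -[_ hx] Cxy.
  exact: (first_hit_shift (b := true) (n := n.+1) UVW hx hy Cxy).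
have mC : measurable (cube W n.+1) by exact: torus_open_measurable.
have := probability_setC (torus_measure R n.+1) mC.
rewrite (torus_measure_cube _ oW mW) => CE.
apply: (@le_lt_trans _ _ (torus_measure R n.+1 (~` cube W n.+1))).
  apply: le_measure; rewrite ?inE; [exact: torus_open_measurable| |exact: SC].
  exact: measurableC.
by rewrite CE -EFinB lte_fin ltrBlDr ltrDl exprn_gt0.
Qed.

(** A nonincreasing sequence tends to its infimum. *)
Lemma exT_le_exTS (R : realType) (alpha : R) n : (exT alpha <= exTS n alpha)%E.
Proof.
have cvg_exTS := ereal_nonincreasing_cvgn (@nonincreasing_exTS R alpha).
rewrite /exT; have /cvg_lim -> // := cvg_exTS.
by apply: ereal_inf_lbound; exists n.
Qed.

Theorem theorem2p3 (R : realType) (alpha : R) (alpha_gt0 : 0 < alpha)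
  (alpha_lt_half : alpha < 1 / 2) : (exT alpha < 1)%E.
Proof.
(* Then alpha = 1 / 2 - 2 d, whereas q = 1 - d - d^2 makes the limiting measure
   d q / (1 - q^2) = q / ((1 + d) (1 + q)) equal to 1 / 2 - O(d) with a constant
   smaller than 2. *)
pose d : R := (1 - 2 * alpha) / 4.
pose e : R := d ^+ 2 / 2.
pose q : R := 1 - d - 2 * e.
have d0 : 0 < d by rewrite /d; lra.
have d4 : d < 1 / 4 by rewrite /d; lra.
have d2 : 0 < d ^+ 2 by exact: exprn_gt0.
have d2d : d ^+ 2 < d / 4 by nra.
pose U := arc 0 d; pose V := arc (d + e) (1 - e); pose W := arc (d - e) (d + e).
(* The bounds are tight: ]d + e, 1 + d - e[ fills the gap between ]d - e, d + e[ and its translate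
   by 1. *)
have UVW u v : U u -> V v -> W (u + v) -> False.
  by apply: arc_add_disjoint; rewrite /e; lra.
have UV : U `&` V = set0 by apply: arc_disjoint; rewrite /e; lra.
have mU : @circle_measure R U = d%:E.
  by rewrite circle_measure_arc ?subr0//; lra.
have mV : @circle_measure R V = q%:E.
  by rewrite circle_measure_arc; [congr EFin; rewrite /q; lra|rewrite /e; lra..].
have mW : @circle_measure R W = (2 * e)%:E.
  by rewrite circle_measure_arc; [congr EFin; lra|rewrite /e; lra..].
have qE : q = 1 - d - d ^+ 2 by rewrite /q /e; lra.
have q_gt0 : 0 < q by lra.
have q_lt1 : q < 1 by lra.
have q2 : 0 < 1 - q ^+ 2 by nra.
have aL : alpha < d * q / (1 - q ^+ 2).
  rewrite ltr_pdivlMr//.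
  have -> : alpha = 1 / 2 - 2 * d by rewrite /d; lra.
  (* Up to a common factor d, the two sides are 1 - 7d/2 + O(d^2) and 1 - d + O(d^2). *)
  rewrite qE; nra.
have q1 : `|q| < 1 by rewrite ger0_norm// ltW.
have [[|m] hm] := geometric_gt q1 aL.
  by exfalso; move: hm; rewrite expr0 subrr mulr0; lra.
have e2 : 0 < 2 * e by rewrite /e; lra.
have [oU oV oW] : [/\ open U, open V & open W] by split; exact: open_arc.
(* Index [m.*2.+1] of [exTS] stands for dimension [m.*2.+2], which is even and at least 2. *)
apply: le_lt_trans (exT_le_exTS alpha m.*2.+1) _.
apply: le_lt_trans (measure_sumset_lt1 m.*2 oU oV oW UVW mW e2).
apply: ereal_inf_lbound; exists (first_hit U V true m.*2.+2) => //.
split; first exact: open_first_hit.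
rewrite -doubleS (torus_measure_odd_first_hit _ oU oV UV _ mU mV) ?lte_fin//.
by rewrite gt_eqF.
Qed.
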